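(* Let $k\ge2$ be an integer, and let $q_1,\ldots,q_k\in[1,\infty)$ and $r_1,\ldots,r_k\in(1,\infty]$ be such that for each $i\in\mathbf{Z}/k\mathbf{Z}$, $$\frac1{r_i}+\sum_{j\ne i}\frac1{q_j}\ge1.$$ Also, let $\varepsilon,C>0$, let $(X_i,\mathbf{P}_i)$ be finite probability spaces, and let $f_i,\tilde f_i:X_i\times X_{i+1}\to\mathbf{C}$ be functions satisfying $\|f_i\|_{S^{q_i}}\le C$, $\|\tilde f_i\|_{S^{q_i}}\le C$ and $\|f_i-\tilde f_i\|_{S^{r_i}}\le\varepsilon$, for $i\in\mathbf{Z}/k\mathbf{Z}$. Then $$\left|\mathbf{E}_{x_1,\ldots,x_k}\prod_{i=1}^kf_i(x_i,x_{i+1})-\mathbf{E}_{x_1,\ldots,x_k}\prod_{i=1}^k\tilde f_i(x_i,x_{i+1})\right|\le kC^{k-1}\varepsilon.$$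
   Context: Indices are modulo $k$ (so $X_{k+1}=X_1$, $x_{k+1}=x_1$), and in $\mathbf{E}_{x_1,\ldots,x_k}$ the $x_i$ are sampled independently from $(X_i,\mathbf{P}_i)$. For finite probability spaces $(X,\mathbf{P}_X),(Y,\mathbf{P}_Y)$ (with full $\sigma$-algebras), $f:X\times Y\to\mathbf{C}$ and $q\in[1,\infty]$, $\|f\|_{S^q}$ is the $\ell^q$ norm (maximum if $q=\infty$) of the singular values of the $|X|\times|Y|$ matrix with $(x,y)$ entry $f(x,y)\sqrt{\mathbf{P}_X(x)\mathbf{P}_Y(y)}$. Convention: $1/\infty=0$. *)

(* Defs.v *)
From HB Require Import structures.
From mathcomp Require Import all_boot all_order all_algebra.
From mathcomp Require Import complex.
From mathcomp Require Import boolp reals constructive_ereal exp.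

Set Implicit Arguments.
Unset Strict Implicit.
Unset Printing Implicit Defensive.

Import Order.TTheory GRing.Theory Num.Theory.
Local Open Scope ring_scope.
Local Open Scope sesquilinear_scope.

Definition is_pmf (R : realType) (X : finType) (P : X -> R) : Prop :=
  (forall x, 0 <= P x) /\ \sum_x P x = 1.

(* Square roots of the eigenvalues, with multiplicity, of the n x n matrix
   A^* A; this matrix is normal, so spectral_diag does list its eigenvalues.
   When n > m this appends n - m zeros to the min(m, n) usual singular
   values, which does not affect the l^q norms for q > 0. *)
Definition singular_value (R : realType) (m n : nat) (A : 'M[R[i]]_(m, n))
    (j : 'I_n) : R :=
  Num.sqrt (complex.Re (spectral_diag (A ^t* *m A) 0 j)).

(* The value at q = -oo is junk. *)
Definition lq_norm (R : realType) (n : nat) (q : \bar R) (s : 'I_n -> R) : R :=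
  match q with
  | q0%:E => (\sum_(j < n) `|s j| `^ q0) `^ q0^-1
  | +oo%E => \big[Num.max/0]_(j < n) `|s j|
  | -oo%E => 0
  end.

Definition weighted_mx (R : realType) (X Y : finType) (P : X -> R) (Q : Y -> R)
    (f : X -> Y -> R[i]) : 'M[R[i]]_(#|X|, #|Y|) :=
  \matrix_(a, b) (f (enum_val a) (enum_val b)
                  * (Num.sqrt (P (enum_val a) * Q (enum_val b)))%:C%C).

Definition schatten_norm (R : realType) (X Y : finType)
    (P : X -> R) (Q : Y -> R) (q : \bar R) (f : X -> Y -> R[i]) : R :=
  lq_norm q (singular_value (weighted_mx P Q f)).

(* Expectation of F(x_1, ..., x_k) for independent x_i distributed as P_i. *)
Definition indep_expect (R : realType) (k : nat) (X : 'I_k -> finType)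
    (P : forall i, X i -> R) (F : (forall i, X i) -> R[i]) : R[i] :=
  \sum_(x : {dffun forall i, X i}) (\prod_(i < k) P i (x i))%:C%C * F x.

(* Main.v *)
(* Telescoping reduces the statement to a Hölder inequality for the cyclic sum
   of functions g_1, ..., g_k, i.e. for the trace of a product of matrices.
   With singular values s_i(0) >= s_i(1) >= ... the sum is at most
   sum_j prod_i s_i(j), and the scalar Hölder inequality (weighted AM-GM)
   concludes.  To bound the cyclic sum, write g_i by Abel summation as a
   nonnegative combination sum_m d_i(m) B_(i,m), where B_(i,m) keeps the
   singular vectors 0, ..., m with weight 1: it is a contraction of rank at
   most m + 1, so the cyclic sum of the B_(i,m_i) is at most
   min_i (m_i + 1) = sum_j prod_i [j <= m_i]; expanding back gives
   sum_j prod_i s_i(j). *)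
Require Import Defs.
From HB Require Import structures.
From mathcomp Require Import all_boot all_order all_algebra.
From mathcomp Require Import perm complex ring.
From mathcomp Require Import boolp reals constructive_ereal sequences exp.

Set Implicit Arguments.
Unset Strict Implicit.
Unset Printing Implicit Defensive.

Import Order.TTheory GRing.Theory Num.Theory.
Local Open Scope ring_scope.

(** * Contractive kernels and Bessel's inequality *)

Definition contractive (C : numClosedFieldType) (S T : finType)
    (G : S -> T -> C) : Prop :=
  forall phi : S -> C,
    \sum_t `|\sum_s phi s * G s t| ^+ 2 <= \sum_s `|phi s| ^+ 2.

(** Zero vectors are allowed ([b i] false), so that truncating a family, padding it, or normalising
    a zero singular vector stays within the notion. *)
Definition suborthonormal (C : numClosedFieldType) (I T : finType)
    (w : I -> T -> C) : Prop :=
  exists b : I -> bool,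
    forall i j, \sum_x w i x * (w j x)^* = ((i == j) && b i)%:R.

Lemma suborthonormal_restrict (C : numClosedFieldType) (I T : finType)
    (w : I -> T -> C) (p : pred I) :
  suborthonormal w -> suborthonormal (fun i x => if p i then w i x else 0).
Proof.
move=> [b hb]; exists (fun i => p i && b i) => i j.
have [->|nij] := eqVneq i j.
  case: (p j); first by rewrite hb eqxx.
  by rewrite big1 // => x _; rewrite mul0r.
case: (p i); last by rewrite big1 // => x _; rewrite mul0r.
case: (p j); last by rewrite big1 // => x _; rewrite rmorph0 mulr0.
by rewrite hb (negPf nij).
Qed.

Lemma sum_normsq_comb (C : numClosedFieldType) (I T : finType)
    (w : I -> T -> C) (b : I -> bool) (c : I -> C) :
  (forall i j, \sum_x w i x * (w j x)^* = ((i == j) && b i)%:R) ->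
  \sum_x `|\sum_i c i * w i x| ^+ 2 = \sum_i (b i)%:R * `|c i| ^+ 2.
Proof.
move=> hw.
transitivity (\sum_x \sum_i \sum_j (c i * (c j)^*) * (w i x * (w j x)^*)).
  apply: eq_bigr => x _; rewrite normCK rmorph_sum mulr_suml.
  apply: eq_bigr => i _; rewrite mulr_sumr; apply: eq_bigr => j _.
  by rewrite rmorphM mulrACA.
rewrite exchange_big; apply: eq_bigr => i _.
rewrite exchange_big (bigD1 i) //= [X in _ + X]big1 => [|j nji].
  by rewrite -mulr_sumr hw eqxx addr0 /= mulrC normCK.
by rewrite -mulr_sumr hw eq_sym (negPf nji) mulr0.
Qed.

(** Expand the squared norm of [phi] minus its projection, which is nonnegative. The vectors are
    conjugated because [c i] pairs without conjugation. Each cross term gives the sum of [|c i|^2],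
    while the projection contributes at most that much. *)
Lemma bessel (C : numClosedFieldType) (I T : finType)
    (w : I -> T -> C) (phi : T -> C) :
  suborthonormal w ->
  \sum_i `|\sum_x phi x * w i x| ^+ 2 <= \sum_x `|phi x| ^+ 2.
Proof.
move=> [b hw]; set c := fun i => \sum_x phi x * w i x.
have hw' i j : \sum_x (w i x)^* * ((w j x)^*)^* = ((i == j) && b i)%:R.
  rewrite -[RHS]conjC_nat -hw rmorph_sum; apply: eq_bigr => x _.
  by rewrite rmorphM.
have h0 : 0 <= \sum_x `|phi x - \sum_i c i * (w i x)^*| ^+ 2.
  by apply: sumr_ge0 => x _; rewrite exprn_ge0.
have e x : `|phi x - \sum_i c i * (w i x)^*| ^+ 2 =
    `|phi x| ^+ 2 + `|\sum_i c i * (w i x)^*| ^+ 2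
    - ((\sum_i phi x * w i x * (c i)^*) + \sum_i c i * (phi x * w i x)^*).
  have -> : \sum_i phi x * w i x * (c i)^* = phi x * (\sum_i c i * (w i x)^*)^*.
    rewrite rmorph_sum mulr_sumr; apply: eq_bigr => i _.
    by rewrite rmorphM /= conjCK -mulrA [w i x * _]mulrC.
  have -> : \sum_i c i * (phi x * w i x)^* = (phi x)^* * \sum_i c i * (w i x)^*.
    rewrite mulr_sumr; apply: eq_bigr => i _.
    by rewrite rmorphM mulrCA.
  rewrite !normCK rmorphB mulrBl !mulrBr [X in X - _ - _]mulrC.
  rewrite [_ * (phi x)^*]mulrC; ring.
move: h0; rewrite (eq_bigr _ (fun x _ => e x)) sumrB !big_split /=.
rewrite (sum_normsq_comb _ hw').
have -> : \sum_x \sum_i phi x * w i x * (c i)^* = \sum_i `|c i| ^+ 2.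
  rewrite exchange_big; apply: eq_bigr => i _.
  by rewrite -mulr_suml normCK.
have -> : \sum_x \sum_i c i * (phi x * w i x)^* = \sum_i `|c i| ^+ 2.
  rewrite exchange_big; apply: eq_bigr => i _.
  by rewrite -mulr_sumr normCK rmorph_sum.
have hB : \sum_i (b i)%:R * `|c i| ^+ 2 <= \sum_i `|c i| ^+ 2.
  apply: ler_sum => i _; case: (b i); rewrite ?mul1r ?mul0r //.
  by rewrite exprn_ge0.
rewrite subr_ge0 => h; rewrite -(lerD2r (\sum_i `|c i| ^+ 2)).
by apply: (le_trans h); rewrite lerD2l.
Qed.

(** Applying [G] to [phi] yields the combination of the [v i] with coefficients [c i], the pairings
    of [phi] with [w i]. Its squared norm is at most the sum of [|c i|^2], and Bessel for [w]
    finishes. *)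
Lemma contractive_svd (C : numClosedFieldType) (I S T : finType)
    (w : I -> S -> C) (v : I -> T -> C) (G : S -> T -> C) :
  suborthonormal w -> suborthonormal v ->
  (forall s t, G s t = \sum_i w i s * v i t) -> contractive G.
Proof.
move=> hw [b hv] hG phi; apply: le_trans (bessel phi hw).
set c := fun i => \sum_x phi x * w i x.
have e t : \sum_s phi s * G s t = \sum_i c i * v i t.
  under eq_bigr do rewrite hG mulr_sumr.
  rewrite exchange_big; apply: eq_bigr => i _.
  by rewrite mulr_suml; apply: eq_bigr => s _; rewrite mulrA.
under eq_bigr do rewrite e.
rewrite (sum_normsq_comb _ hv); apply: ler_sum => i _.
case: (b i); rewrite ?mul1r ?mul0r //.
by rewrite exprn_ge0.
Qed.

Lemma suborthonormal_normsq_le1 (C : numClosedFieldType) (I T : finType)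
    (w : I -> T -> C) (i : I) :
  suborthonormal w -> \sum_x `|w i x| ^+ 2 <= 1.
Proof.
move=> [b hb]; under eq_bigr do rewrite normCK.
by rewrite hb; case: (_ && _).
Qed.

(** * Sums along paths and cycles over a single type *)

Lemma sum_mul_le1 (C : numClosedFieldType) (T : finType) (u v : T -> C) :
  \sum_x `|u x| ^+ 2 <= 1 -> \sum_x `|v x| ^+ 2 <= 1 ->
  `|\sum_x u x * v x| <= 1.
Proof.
move=> hu hv; apply: (le_trans (ler_norm_sum _ _ _)).
have h : \sum_x `|u x * v x| *+ 2 <= \sum_x (`|u x| ^+ 2 + `|v x| ^+ 2).
  apply: ler_sum => x _; rewrite normrM -subr_ge0.
  have -> : `|u x| ^+ 2 + `|v x| ^+ 2 - `|u x| * `|v x| *+ 2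
      = (`|u x| - `|v x|) ^+ 2 by ring.
  by rewrite -realEsqr rpredB // normr_real.
rewrite -(ler_pMn2r (n:=2)) // -sumrMnl; apply: (le_trans h).
by rewrite big_split /= mulr2n lerD.
Qed.

Lemma sum_ffun_recl (V : nmodType) (T : finType) (n : nat)
    (F : {ffun 'I_n.+1 -> T} -> V) :
  \sum_x F x =
  \sum_(y : {ffun 'I_n -> T}) \sum_a
    F [ffun i => if unlift ord0 i is Some j then y j else a].
Proof.
rewrite pair_bigA /=.
rewrite (reindex (fun p : {ffun 'I_n -> T} * T =>
  [ffun i => if unlift ord0 i is Some j then p.1 j else p.2])) //=.
exists (fun x : {ffun 'I_n.+1 -> T} => ([ffun j => x (lift ord0 j)], x ord0)).
  move=> [y a] _ /=; rewrite ffunE unlift_none; congr (_, _).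
  by apply/ffunP => j; rewrite !ffunE liftK.
move=> x _; apply/ffunP => i; rewrite !ffunE /=.
by case: unliftP => [j ->|->]; rewrite ?ffunE.
Qed.

(** Induction on the length: summing out the first vertex replaces [phi] by its image under [G 0],
    which stays in the unit ball. The one-vertex path is Cauchy-Schwarz. *)
Lemma path_sum_le1 (C : numClosedFieldType) (T : finType) (n : nat)
    (G : nat -> T -> T -> C) (phi psi : T -> C) :
  (forall i, (i < n)%N -> contractive (G i)) ->
  \sum_x `|phi x| ^+ 2 <= 1 -> \sum_x `|psi x| ^+ 2 <= 1 ->
  `| \sum_(x : {ffun 'I_n.+1 -> T}) phi (x ord0)
      * (\prod_(i < n) G i (x (widen_ord (leqnSn n) i)) (x (lift ord0 i)))
      * psi (x ord_max) | <= 1.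
Proof.
elim: n G phi => [|n IHn] G phi hG hphi hpsi.
  rewrite sum_ffun_recl.
  have y0 : {ffun 'I_0 -> T} by apply: finfun => -[].
  rewrite (big_pred1 y0) => [|y]; last first.
    by symmetry; apply/eqP/ffunP => -[].
  rewrite (eq_bigr (fun a => phi a * psi a)); first exact: sum_mul_le1.
  move=> a _; rewrite big_ord0 mulr1.
  have -> : ord_max = ord0 :> 'I_1 by apply: val_inj.
  by rewrite !ffunE unlift_none.
pose phi' t := \sum_s phi s * G 0%N s t.
have hphi' : \sum_x `|phi' x| ^+ 2 <= 1.
  by apply: le_trans hphi; apply: (hG 0%N).
have hG' i : (i < n)%N -> contractive (G i.+1) by move=> hi; apply: hG.
have := IHn (fun i => G i.+1) phi' hG' hphi' hpsi.
rewrite [in X in _ -> X]sum_ffun_recl; congr (`| _ | <= 1).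
apply: eq_bigr => y _; rewrite /phi' -mulrA mulr_suml; apply: eq_bigr => a _.
rewrite big_ord_recl !ffunE.
have -> : unlift ord0 (widen_ord (leqnSn n.+1) ord0) = None.
  by rewrite -[RHS](unlift_none (@ord0 n.+1)); congr unlift; apply: val_inj.
have -> : (ord_max : 'I_n.+2) = lift ord0 ord_max by apply: val_inj.
rewrite unlift_none !liftK -!mulrA; congr (_ * (_ * (_ * _))).
apply: eq_bigr => i _; rewrite !ffunE.
have -> : widen_ord (leqnSn n.+1) (lift ord0 i)
    = lift ord0 (widen_ord (leqnSn n) i) by apply: val_inj.
by rewrite !liftK.
Qed.

Lemma ordS_addr (n : nat) (i c : 'I_n.+1) : ordS (i + c) = ordS i + c.
Proof. by apply: val_inj; rewrite /= -[in LHS]addn1 !modnDml addnAC addn1. Qed.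

(** Cutting the cycle at the rank-one edge [i0] leaves a path through the other edges, with [v] at
    its first vertex and [u] at its last. *)
Lemma cyclic_sum_le1 (C : numClosedFieldType) (T : finType) (n : nat)
    (G : 'I_n.+1 -> T -> T -> C) (i0 : 'I_n.+1) (u v : T -> C) :
  (forall i, i != i0 -> contractive (G i)) ->
  (forall s t, G i0 s t = u s * v t) ->
  \sum_x `|u x| ^+ 2 <= 1 -> \sum_x `|v x| ^+ 2 <= 1 ->
  `| \sum_(x : {ffun 'I_n.+1 -> T}) \prod_i G i (x i) (x (ordS i)) | <= 1.
Proof.
move=> hG hG0 hu hv.
(* Rotation by [c] takes [ord_max] to [i0], so the edge to cut becomes the one from the last vertex
   back to [ord0]. *)
pose c := i0 - ord_max.
pose H i := G (inord i + c).
have hH i : (i < n)%N -> contractive (H i).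
  move=> hi; apply: hG; apply/eqP => e.
  have : inord i = ord_max :> 'I_n.+1.
    by apply: (addIr c); rewrite e /c addrC subrK.
  move/(congr1 val); rewrite /= inordK ?ltnS 1?ltnW // => ein.
  by rewrite ein ltnn in hi.
have := path_sum_le1 hH hv hu; congr (`| _ | <= 1).
pose rot (d : 'I_n.+1) (x : {ffun 'I_n.+1 -> T}) := [ffun i => x (i + d)].
rewrite [RHS](reindex (rot (- c))); last first.
  by exists (rot c) => x _; apply/ffunP => i; rewrite !ffunE ?subrK ?addrK.
apply: eq_bigr => x _.
rewrite (reindex (fun i => i + c)); last first.
  by exists (fun i => i - c) => i _; rewrite ?subrK ?addrK.
rewrite big_ord_recr /= !ffunE ordS_addr !addrK.
have -> : ord_max + c = i0 by rewrite /c addrC subrK.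
have -> : ordS ord_max = ord0 :> 'I_n.+1 by apply: val_inj; rewrite /= modnn.
rewrite hG0 [RHS]mulrC [u _ * _]mulrC mulrAC; congr (_ * _).
apply: eq_bigr => i _; rewrite !ffunE ordS_addr !addrK /H.
have -> : inord i = widen_ord (leqnSn n) i.
  by apply: val_inj; rewrite /= inordK // ltnS ltnW.
have -> // : ordS (widen_ord (leqnSn n) i) = lift ord0 i.
by apply: val_inj; rewrite /= modn_small // ltnS.
Qed.

(** * Passing to the disjoint union of the vertex types *)

Lemma untag_Tagged (V : Type) (v0 : V) (I : eqType) (X : I -> Type) (i : I)
    (F : X i -> V) (x : X i) :
  untag v0 F (Tagged X x) = F x.
Proof. by rewrite (@untagE _ _ _ v0 i F (Tagged X x) erefl). Qed.

Lemma sum_untag (V : nmodType) (I : finType) (X : I -> finType) (i : I)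
    (F : X i -> V) :
  \sum_(u : {i : I & X i}) untag 0 F u = \sum_x F x.
Proof.
transitivity (\sum_j \sum_(x : X j) untag 0 F (Tagged X x)).
  rewrite (sig_big_dep xpredT (fun j => xpredT)
    (fun j (x : X j) => untag 0 F (Tagged X x))) /=.
  by apply: eq_bigr => -[].
rewrite (bigD1 i) //= [X in _ + X]big1 ?addr0 => [|j nji].
  by apply: eq_bigr => x _; rewrite untag_Tagged.
by apply: big1 => x _; rewrite untag_dflt //=; apply/eqP.
Qed.

Section SigmaKernel.

Variables (C : numClosedFieldType) (I : finType) (X : I -> finType).

(** Extension by zero to the disjoint union, so that kernels between different types become kernels
    on one type, as [cyclic_sum_le1] requires. *)
Definition sigma_kernel (i j : I) (B : X i -> X j -> C)
    (s t : {i : I & X i}) : C :=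
  untag 0 (fun a => untag 0 (fun b => B a b) t) s.

Lemma sigma_kernel_Tagged (i j : I) (B : X i -> X j -> C) (a : X i) (b : X j) :
  sigma_kernel B (Tagged X a) (Tagged X b) = B a b.
Proof. by rewrite /sigma_kernel !untag_Tagged. Qed.

Lemma sigma_kernel_tag (i j : I) (B : X i -> X j -> C) (s t : {i : I & X i}) :
  tag s != i -> sigma_kernel B s t = 0.
Proof. by move=> ?; rewrite /sigma_kernel untag_dflt. Qed.

Lemma comp_untag (V W : Type) (v0 : V) (w0 : W) (i : I) (F : X i -> V)
    (h : {i : I & X i} -> V -> W) (s : {i : I & X i}) :
  (forall s, h s v0 = w0) ->
  h s (untag v0 F s) = untag w0 (fun x => h (Tagged X x) (F x)) s.
Proof.
move=> h0; case: s => j x; have [e|ne] := eqVneq j i.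
  by subst j; rewrite !untag_Tagged.
by rewrite !untag_dflt.
Qed.

Lemma sum_mul_untag (i : I) (phi : {i : I & X i} -> C) (F : X i -> C) :
  \sum_s phi s * untag 0 F s = \sum_a phi (Tagged X a) * F a.
Proof.
rewrite -sum_untag; apply: eq_bigr => s _.
by rewrite (@comp_untag _ _ 0 0 _ _ (fun s x => phi s * x)) // => ?; rewrite mulr0.
Qed.

Lemma sum_normsq_untag (i : I) (F : X i -> C) :
  \sum_s `|untag 0 F s| ^+ 2 = \sum_a `|F a| ^+ 2.
Proof.
rewrite -sum_untag; apply: eq_bigr => s _.
rewrite (@comp_untag _ _ 0 0 _ _ (fun=> fun x => `|x| ^+ 2)) // => _.
by rewrite normr0 expr0n.
Qed.

(** The image of [phi] lives on the fibre over [j] and depends only on [phi] restricted to the fibre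
    over [i]; discarding the rest of [phi] can only lower its norm. *)
Lemma contractive_sigma_kernel (i j : I) (B : X i -> X j -> C) :
  contractive B -> contractive (sigma_kernel B).
Proof.
move=> hB phi.
have e t : \sum_s phi s * sigma_kernel B s t =
    untag 0 (fun b => \sum_a phi (Tagged X a) * B a b) t.
  rewrite sum_mul_untag; case: t => j' b; have [ej|nej] := eqVneq j' j.
    by subst j'; rewrite untag_Tagged; under eq_bigr do rewrite untag_Tagged.
  by rewrite untag_dflt // big1 // => a _; rewrite untag_dflt // mulr0.
under eq_bigr do rewrite e.
rewrite sum_normsq_untag; apply: le_trans (hB _) _.
rewrite -(sum_untag (fun a => `|phi (Tagged X a)| ^+ 2)).
apply: ler_sum => -[i' a] _; have [ei|nei] := eqVneq i' i.
  by subst i'; rewrite untag_Tagged.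
by rewrite untag_dflt // exprn_ge0.
Qed.

End SigmaKernel.

(** Dependent functions embed as the [y] with [tag (y i) = i] for all [i]. Any other [y] has a
    vanishing factor, at an index where the tag is wrong. *)
Lemma sum_dffun_sigma (C : numClosedFieldType) (I : finType) (X : I -> finType)
    (succ : I -> I) (B : forall i, X i -> X (succ i) -> C) :
  \sum_(x : {dffun forall i, X i}) \prod_i B i (x i) (x (succ i)) =
  \sum_(y : {ffun I -> {i : I & X i}})
    \prod_i sigma_kernel (B i) (y i) (y (succ i)).
Proof.
pose h (x : {dffun forall i, X i}) : {ffun I -> {i : I & X i}} :=
  [ffun i => Tagged X (x i)].
have h_inj : injective h.
  move=> x x' /ffunP e; apply/ffunP => i; move: (e i); rewrite !ffunE => /eqP.
  by rewrite eq_Tagged /= => /eqP.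
rewrite [RHS](bigID [in h @: setT]) /= [X in _ = _ + X]big1 ?addr0; last first.
  move=> y ny; case: (boolP [forall i, tag (y i) == i]) => [/forallP ht|].
    case/imsetP: ny; exists (finfun (fun i => etagged (eqP (ht i)))) => //.
    by apply/ffunP => i; rewrite !ffunE etaggedK.
  rewrite negb_forall => /existsP [i hi].
  by rewrite (bigD1 i) //= sigma_kernel_tag // mul0r.
rewrite big_imset /=; last by move=> ? ? _ _; apply: h_inj.
apply: eq_big => [x|x _]; first by rewrite inE.
by apply: eq_bigr => i _; rewrite !ffunE sigma_kernel_Tagged.
Qed.

Lemma dep_cyclic_sum_le1 (C : numClosedFieldType) (n : nat)
    (X : 'I_n.+1 -> finType) (B : forall i, X i -> X (ordS i) -> C)
    (i0 : 'I_n.+1) (u : X i0 -> C) (v : X (ordS i0) -> C) :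
  (forall i, i != i0 -> contractive (B i)) ->
  (forall a b, B i0 a b = u a * v b) ->
  \sum_a `|u a| ^+ 2 <= 1 -> \sum_b `|v b| ^+ 2 <= 1 ->
  `| \sum_(x : {dffun forall i, X i}) \prod_i B i (x i) (x (ordS i)) | <= 1.
Proof.
move=> hB hB0 hu hv; rewrite (sum_dffun_sigma B).
apply: (@cyclic_sum_le1 _ _ _ (fun i => sigma_kernel (B i)) i0
  (untag 0 u) (untag 0 v)).
- by move=> i ni; apply: contractive_sigma_kernel; apply: hB.
- move=> [i a] [j b]; rewrite /sigma_kernel.
  have [ei|nei] := eqVneq i i0; last first.
    by rewrite untag_dflt // [untag 0 u _]untag_dflt // mul0r.
  subst i; rewrite !untag_Tagged; have [ej|nej] := eqVneq j (ordS i0).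
    by subst j; rewrite !untag_Tagged hB0.
  by rewrite untag_dflt // [untag 0 v _]untag_dflt // mulr0.
- by rewrite sum_normsq_untag.
- by rewrite sum_normsq_untag.
Qed.

(** * Bounding a cyclic sum by products of sorted singular values *)

(** Abel summation: [d m] is the drop from [s m] to the next value, where [s] is continued by 0
    beyond [N] so that the last drop is the last value itself. *)
Lemma nonincr_layer_cake (C : numClosedFieldType) (N : nat) (s : 'I_N -> C) :
  (forall j, 0 <= s j) -> (forall i j : 'I_N, (i <= j)%N -> s j <= s i) ->
  exists d : 'I_N -> C, (forall m, 0 <= d m) /\
    forall j, s j = \sum_m d m * (j <= m)%:R.
Proof.
move=> s0 sN; pose s' n := oapp s 0 (insub n : option 'I_N).
have s'E (j : 'I_N) : s' j = s j by rewrite /s' valK.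
have s'N n : (N <= n)%N -> s' n = 0 by move=> hn; rewrite /s' insubF // ltnNge hn.
exists (fun m => s' m - s' m.+1); split=> [m|j].
  rewrite s'E subr_ge0; have [h|h] := ltnP m.+1 N; last by rewrite s'N.
  by rewrite -[m.+1]/(val (Ordinal h)) s'E sN //=.
transitivity (\sum_(j <= m < N) (s' m - s' m.+1)).
  rewrite (telescope_sumr_eq (fun m => - s' m)) => [||m _].
  - by rewrite opprK s'N // oppr0 add0r s'E.
  - exact: ltnW.
  - by rewrite opprK addrC.
rewrite big_geq_mkord big_mkcond; apply: eq_bigr => m _.
by case: (j <= m)%N; rewrite ?mulr1 ?mulr0.
Qed.

Section CyclicSumSvd.

Variables (C : numClosedFieldType) (n N : nat) (X : 'I_n.+1 -> finType).
Variables (w : forall i, 'I_N -> X i -> C) (v : forall i, 'I_N -> X (ordS i) -> C).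
Hypothesis hw : forall i, suborthonormal (@w i).
Hypothesis hv : forall i, suborthonormal (@v i).

(** Truncation zeroes the vectors [w j] instead of shortening the sum, so that
    [suborthonormal_restrict] and [contractive_svd] give contractivity. *)
Let B (i : 'I_n.+1) (m : 'I_N) (a : X i) (b : X (ordS i)) : C :=
  \sum_(j < N) (if (j <= m)%N then w j a else 0) * v j b.

Lemma truncated_cyclic_sum_le (m : 'I_n.+1 -> 'I_N) :
  `| \sum_(x : {dffun forall i, X i}) \prod_i B (m i) (x i) (x (ordS i)) |
  <= \sum_(j < N) \prod_i (j <= m i)%:R.
Proof.
(* Only the factor of least rank is expanded into rank-one terms; each of
   the resulting cyclic sums has modulus at most 1. *)
have [i0 _ hi0] := arg_minnP (fun i => val (m i)) (erefl (xpredT (@ord0 n))).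
pose B' (j : 'I_N) i (a : X i) (b : X (ordS i)) : C :=
  if i == i0 then (if (j <= m i)%N then w j a else 0) * v j b
  else B (m i) a b.
have -> : \sum_(x : {dffun forall i, X i}) \prod_i B (m i) (x i) (x (ordS i)) =
    \sum_(j < N) \sum_(x : {dffun forall i, X i}) \prod_i B' j i (x i) (x (ordS i)).
  rewrite exchange_big; apply: eq_bigr => x _.
  rewrite (bigD1 i0) //= mulr_suml; apply: eq_bigr => j _.
  rewrite [RHS](bigD1 i0) //= /B' eqxx; congr (_ * _).
  by apply: eq_bigr => i /negPf ->.
apply: (le_trans (ler_norm_sum _ _ _)); apply: ler_sum => j _.
(* Beyond [m i0] the term is zero. Otherwise minimality of [m i0] makes every indicator on the right
   equal to 1. *)
have [hj|hj] := leqP j (m i0); last first.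
  rewrite big1 ?normr0 => [|x _]; first by apply: prodr_ge0 => i _; rewrite ler0n.
  by rewrite (bigD1 i0) //= /B' eqxx leqNgt hj !mul0r.
rewrite [leRHS]big1 => [|i _]; last by rewrite (leq_trans hj) // hi0.
apply: (dep_cyclic_sum_le1 (i0 := i0) (u := @w i0 j) (v := @v i0 j)).
- move=> i /negPf ni phi; rewrite /B' ni.
  apply: (contractive_svd (w := fun (j : 'I_N) a => if (j <= m i)%N then w j a else 0) _ (hv i)) => //.
  exact: (suborthonormal_restrict (fun j : 'I_N => (j <= m i)%N) (hw i)).
- by move=> a b; rewrite /B' eqxx hj.
- exact: suborthonormal_normsq_le1.
- exact: suborthonormal_normsq_le1.
Qed.

(** Expanding every [s i] by [nonincr_layer_cake] writes both sides as sums over [m] with the same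
    nonnegative coefficients, and [truncated_cyclic_sum_le] compares them term by term. *)
Lemma cyclic_sum_svd_le (s : 'I_n.+1 -> 'I_N -> C) :
  (forall i j, 0 <= s i j) ->
  (forall i (j j' : 'I_N), (j <= j')%N -> s i j' <= s i j) ->
  `| \sum_(x : {dffun forall i, X i})
       \prod_i \sum_j s i j * (w j (x i) * v j (x (ordS i))) |
  <= \sum_j \prod_i s i j.
Proof.
move=> s0 sN.
have /choice [d hd] := fun i => nonincr_layer_cake (s0 i) (sN i).
have e (x : {dffun forall i, X i}) :
    \prod_i \sum_j s i j * (w j (x i) * v j (x (ordS i))) =
    \sum_(m : {ffun 'I_n.+1 -> 'I_N}) (\prod_i d i (m i)) *
      \prod_i B (m i) (x i) (x (ordS i)).
  under [RHS]eq_bigr do rewrite -big_split /=.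
  rewrite -(bigA_distr_bigA (fun i m => d i m * B m (x i) (x (ordS i)))).
  apply: eq_bigr => i _.
  under [LHS]eq_bigr do rewrite (hd i).2 mulr_suml.
  rewrite exchange_big; apply: eq_bigr => m _.
  rewrite mulr_sumr; apply: eq_bigr => j _.
  by rewrite -mulrA; case: (j <= m)%N; rewrite ?mul1r ?mul0r.
under eq_bigr do rewrite e.
rewrite exchange_big; under eq_bigr do rewrite -mulr_sumr.
apply: (le_trans (ler_norm_sum _ _ _)).
have -> : \sum_j \prod_i s i j =
    \sum_(m : {ffun 'I_n.+1 -> 'I_N}) (\prod_i d i (m i)) *
      \sum_(j < N) \prod_i (j <= m i)%:R.
  under [RHS]eq_bigr do rewrite mulr_sumr.
  rewrite exchange_big; apply: eq_bigr => j _.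
  under [RHS]eq_bigr do rewrite -big_split /=.
  rewrite -(bigA_distr_bigA (fun i m => d i m * (j <= m)%:R)).
  by apply: eq_bigr => i _; rewrite (hd i).2.
have d0 (m : {ffun 'I_n.+1 -> 'I_N}) : 0 <= \prod_i d i (m i).
  by apply: prodr_ge0 => i _; apply: (hd i).1.
apply: ler_sum => m _; rewrite normrM ger0_norm //.
by apply: ler_wpM2l => //; apply: truncated_cyclic_sum_le.
Qed.

End CyclicSumSvd.

(** * Singular value decomposition of a matrix *)

Section SingularValueDecomposition.

Local Open Scope sesquilinear_scope.

(** Diagonalise [A ^t* *m A] by a unitary [V]. The columns of [U = A *m V ^t*] are then orthogonal
    with squared norms the eigenvalues, and [A = U *m V]; dividing these columns by the singular
    values gives [w], and the rows of [V] give [v]. *)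
Lemma svd_mx (R : realType) (m n : nat) (A : 'M[R[i]]_(m, n)) :
  exists (w : 'I_n -> 'I_m -> R[i]) (v : 'I_n -> 'I_n -> R[i]),
    [/\ suborthonormal w, suborthonormal v &
      forall a b, A a b = \sum_j (singular_value A j)%:C%C * (w j a * v j b)].
Proof.
set M := A ^t* *m A; set V := spectralmx M; set D := spectral_diag M.
have hV : V \is unitarymx by apply: spectral_unitarymx.
have hM : M = V ^t* *m diag_mx D *m V.
  rewrite -invmx_unitary //; apply/orthomx_spectralP/normalmxP.
  by rewrite /M !trmx_mul !map_mxM /= trmxCK.
pose U := A *m V ^t*.
have hU : U ^t* *m U = diag_mx D.
  rewrite /U trmx_mul map_mxM /= trmxCK mulmxA -(mulmxA V) -/M hM.
  by rewrite !mulmxA (unitarymxP hV) mul1mx -mulmxA (unitarymxP hV) mulmx1.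
have hA : A = U *m V.
  by rewrite /U -mulmxA -(invmx_unitary hV) mulVmx ?mulmx1 // unitarymx_unit.
have UU i j : \sum_a U a i * (U a j)^* = D 0 j * (i == j)%:R.
  move/matrixP/(_ j i): hU; rewrite !mxE => h.
  rewrite eq_sym mulr_natr -h.
  by apply: eq_bigr => a _; rewrite !mxE mulrC.
have D0 j : 0 <= D 0 j.
  have <- : \sum_a U a j * (U a j)^* = D 0 j by rewrite UU eqxx mulr1.
  by apply: sumr_ge0 => a _; apply: mul_conjC_ge0.
pose s j := (singular_value A j)%:C%C : R[i].
(* The eigenvalue is a nonnegative real, so the real part and the square root in [singular_value]
   lose nothing. *)
have sD j : s j ^+ 2 = D 0 j.
  rewrite -rmorphXn /= /singular_value -/M -/D.
  have h := RRe_real (ger0_real (D0 j)).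
  by rewrite sqr_sqrtr // -lecR h.
have s_conj j : (s j)^* = s j.
  by apply/conj_Creal; apply/complex_realP; exists (singular_value A j).
(* Since the inverse of 0 is 0, the left vector of a zero singular value is the zero vector. *)
exists (fun j a => (s j)^-1 * U a j), (fun j b => V j b); split.
- exists (fun j => s j != 0) => i j.
  transitivity ((s i)^-1 * (s j)^-1 * \sum_a U a i * (U a j)^*).
    rewrite mulr_sumr; apply: eq_bigr => a _.
    by rewrite rmorphM fmorphV /= s_conj mulrACA.
  rewrite UU; have [->|_] := eqVneq i j; last by rewrite !mulr0.
  rewrite mulr1 -sD /=; have [->|nz] := eqVneq (s j) 0.
    by rewrite invr0 !mul0r.
  by rewrite /= -invfM -expr2 mulVf // expf_neq0.
- exists xpredT => i j; move/unitarymxP/matrixP/(_ i j): hV.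
  rewrite !mxE andbT => <-; by apply: eq_bigr => b _; rewrite !mxE.
move=> a b; rewrite {1}hA mxE; apply: eq_bigr => j _; rewrite -/(s j).
have [z|nz] := eqVneq (s j) 0; last by rewrite !mulrA divff ?mul1r.
(* With a zero singular value, column [j] of [U] has norm 0 and therefore vanishes, so nothing is
   lost by dropping it. *)
have : \sum_a U a j * (U a j)^* = 0 by rewrite UU -sD z expr0n mul0r.
move/psumr_eq0P => /(_ (fun a _ => mul_conjC_ge0 _)) /(_ a isT) /eqP.
by rewrite mul_conjC_eq0 => /eqP ->; rewrite mulr0 !mul0r mulr0.
Qed.

End SingularValueDecomposition.

(** * The scalar Hölder inequality *)

(* Weighted AM-GM, from [ln x <= x - 1] at [x = a i / mu] where [mu] is the
   weighted mean; total weight above 1 is harmless because [a i <= 1]. *)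
Lemma prod_powR_le_wmean (R : realType) (I : finType) (theta a : I -> R) :
  (forall i, 0 <= theta i) -> 1 <= \sum_i theta i ->
  (forall i, 0 <= a i <= 1) ->
  \prod_i a i `^ theta i <= \sum_i theta i / (\sum_j theta j) * a i.
Proof.
move=> th0 th1 ha; set Th := \sum_j theta j in th1 *.
have Th0 : 0 < Th by apply: lt_le_trans th1.
pose l i := theta i / Th.
have l0 i : 0 <= l i by rewrite divr_ge0 // ltW.
have l1 : \sum_i l i = 1 by rewrite -mulr_suml divff // gt_eqF.
have a0 i : 0 <= a i by case/andP: (ha i).
(* A zero base with nonzero exponent kills the product. Once this is excluded, [ln] is only needed
   at positive [a i], a zero base having exponent 0 and power 1. *)
have [/existsP [i /andP [/eqP ai0 ti0]]|] :=
    boolP [exists i, (a i == 0) && (theta i != 0)].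
  rewrite (bigD1 i) //= ai0 powR0 // mul0r.
  by apply: sumr_ge0 => j _; rewrite mulr_ge0 // -/(l j).
rewrite negb_exists => /forallP hz.
have apos i : theta i != 0 -> 0 < a i.
  by move=> ti; have := hz i; rewrite ti andbT lt0r a0 andbT.
set mu := \sum_i _.
have mu0 : 0 < mu.
  have [i ti] : exists i, theta i != 0.
    apply/existsP; apply: contraTT th1; rewrite negb_exists => /forallP h.
    rewrite /Th big1 ?lt_geF ?ltr01 // => i _.
    by apply/eqP; have := h i; rewrite negbK.
  rewrite /mu (bigD1 i) //=; apply: ltr_wpDr.
    by apply: sumr_ge0 => j _; rewrite mulr_ge0 // -/(l j).
  by rewrite mulr_gt0 ?apos // divr_gt0 // lt_neqAle eq_sym ti th0.
have e i : a i `^ theta i = expR (theta i * ln (a i)).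
  rewrite /powR; case: eqP => // ai0.
  have [->|/apos] := eqVneq (theta i) 0; first by rewrite mul0r expR0.
  by rewrite ai0 ltxx.
under eq_bigr do rewrite e.
rewrite -expR_sum -[leRHS]lnK ?posrE // ler_expR.
(* The weights [l i] sum to 1 and the [l i * a i] sum to [mu], so the intermediate sum is exactly
   [ln mu]. *)
apply: (@le_trans _ _ (\sum_i l i * (ln mu + (a i / mu - 1)))); last first.
  under eq_bigr do rewrite addrA mulrBr mulr1 mulrDr.
  rewrite sumrB big_split /= -mulr_suml l1 mul1r.
  under [X in _ + X - _]eq_bigr do rewrite mulrA.
  by rewrite -mulr_suml -/mu divff ?gt_eqF // addrK.
apply: ler_sum => i _.
have [ti0|ti0] := eqVneq (theta i) 0; first by rewrite /l ti0 !mul0r.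
have ai0 := apos i ti0.
apply: (@le_trans _ _ (l i * ln (a i))).
  rewrite -subr_le0 -mulrBl mulr_ge0_le0 //; last first.
    by apply: ln_le0; case/andP: (ha i).
  by rewrite subr_ge0 /l ler_pdivrMr // ler_peMr.
apply: ler_wpM2l => //.
rewrite -{1}(mulfVK (lt0r_neq0 mu0) (a i)) lnM ?posrE ?divr_gt0 // addrC lerD2l.
have -> : a i / mu = 1 + (a i / mu - 1) by rewrite addrC subrK.
rewrite [leRHS]addrAC subrr add0r; apply: le_ln1Dx.
by rewrite ltrBDl addrN divr_gt0.
Qed.

(** Here [theta i] plays the reciprocal exponent, with 0 for the exponent infinity, and [a i] the
    normalised power of [s i]. AM-GM at each [j] leaves weighted means of the [a i j], whose sum
    over [j] is at most 1. *)
Lemma sum_prod_le_holder (R : realType) (I J : finType)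
    (theta c : I -> R) (a s : I -> J -> R) :
  (forall i, 0 <= theta i) -> 1 <= \sum_i theta i -> (forall i, 0 <= c i) ->
  (forall i j, 0 <= a i j) -> (forall i, \sum_j a i j <= 1) ->
  (forall i j, 0 <= s i j <= c i * a i j `^ theta i) ->
  \sum_j \prod_i s i j <= \prod_i c i.
Proof.
move=> th0 th1 c0 a0 a1 hs.
have ha i j : 0 <= a i j <= 1.
  rewrite a0 (le_trans _ (a1 i)) // (bigD1 j) //= lerDl.
  exact: sumr_ge0.
have Th0 : 0 < \sum_i theta i by apply: lt_le_trans th1.
have pc0 : 0 <= \prod_i c i by apply: prodr_ge0.
apply: (@le_trans _ _ (\sum_j (\prod_i c i) *
    \sum_i theta i / (\sum_i theta i) * a i j)).
  apply: ler_sum => j _.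
  apply: (@le_trans _ _ (\prod_i (c i * a i j `^ theta i))).
    by apply: ler_prod => i _; apply: hs.
  rewrite big_split ler_wpM2l //.
  by apply: prod_powR_le_wmean => // i.
rewrite -mulr_sumr -[leRHS]mulr1 ler_wpM2l //.
rewrite exchange_big /= -(divff (lt0r_neq0 Th0)) mulr_suml.
apply: ler_sum => i _; rewrite -mulr_sumr -[leRHS]mulr1 ler_wpM2l //.
by rewrite divr_ge0 // ltW.
Qed.

(** Puts an [lq_norm] bound into the form [sum_prod_le_holder] takes. For finite [p] the witness is
    the [p]-th power of [s j / c]. The condition on [F] says that [s] and [t] have the same nonzero
    entries with multiplicity. *)
Lemma lq_norm_le_dominated (R : realType) (n : nat) (J : finType) (p : \bar R)
    (t : 'I_n -> R) (s : J -> R) (c : R) :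
  (1 <= p)%E -> 0 < c -> (forall j, 0 <= s j) -> (forall j, 0 <= t j) ->
  (forall F : R -> R, F 0 = 0 -> \sum_j F (s j) = \sum_j F (t j)) ->
  lq_norm p t <= c ->
  exists a : J -> R, [/\ forall j, 0 <= a j, \sum_j a j <= 1 &
    forall j, s j <= c * a j `^ fine p^-1%E].
Proof.
case: p => [p||] //= p1 c0 s0 t0 hst hc.
  rewrite lee_fin in p1.
  have p0 : 0 < p by apply: lt_le_trans p1.
  exists (fun j => (s j / c) `^ p); split=> [j||j].
  - exact: powR_ge0.
  - rewrite (hst (fun x => (x / c) `^ p)) ?mul0r ?powR0 ?gt_eqF //.
    under eq_bigr do rewrite powRM ?invr_ge0 ?(ltW c0) //.
    rewrite -mulr_suml -(powR_inv1 (ltW c0)) powRAC powR_inv1 ?powR_ge0 //.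
    rewrite ler_pdivrMr ?powR_gt0 // mul1r.
    have h0 : 0 <= \sum_j t j `^ p by apply: sumr_ge0 => j _; apply: powR_ge0.
    have -> : \sum_j t j `^ p = ((\sum_j `|t j| `^ p) `^ p^-1) `^ p.
      under [in RHS]eq_bigr do rewrite ger0_norm //.
      by rewrite -powRrM mulVf ?gt_eqF // powRr1.
    apply: ge0_ler_powR => //; rewrite ?nnegrE ?powR_ge0 ?ltW //.
  - rewrite inver gt_eqF //= -powRrM mulfV ?gt_eqF // powRr1.
      by rewrite mulrC mulfVK ?gt_eqF.
    by rewrite divr_ge0 // ltW.
(* For [p = +oo] the exponent is 0 and 0 to the power 0 is 1, so the claim is just [s j <= c]. *)
exists (fun=> 0); split=> [//||j]; first by rewrite big1.
rewrite powRr0 mulr1.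
have tc i : t i <= c.
  by apply: le_trans hc; apply: le_trans (ler_norm _) (le_bigmax _ _ i).
(* Counts the entries above [c]; this indicator is 0 at 0 because [c] is positive, so the count is
   the same for [t]. *)
have h : \sum_j (c < s j)%R%:R = 0 :> R.
  have c00 : (c < 0)%R%:R = 0 :> R by rewrite lt_gtF.
  rewrite (hst (fun x => (c < x)%R%:R) c00).
  by apply: big1 => i _; rewrite ltNge tc.
have sj := psumr_eq0P (fun i _ => ler0n R (c < s i)%R) h (i := j) isT.
by move/eqP: sj; rewrite pnatr_eq0 eqb0 -leNgt.
Qed.

(** * Sorted and padded decompositions of functions *)

Lemma sort_perm_decreasing (R : realDomainType) (N : nat) (t : 'I_N -> R) :
  exists p : {perm 'I_N}, forall i j : 'I_N, (i <= j)%N -> t (p j) <= t (p i).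
Proof.
pose T := [tuple t i | i < N]; pose S := sort_tuple >=%R T.
have /tuple_permP [p hp] : perm_eq S T by rewrite perm_sort.
have tS i : t (p i) = nth 0 S i.
  by rewrite hp (nth_map i) ?size_enum_ord // nth_ord_enum !tnth_mktuple.
exists p => i j ij; rewrite !tS.
have : sorted >=%R S by apply: sort_sorted => x y; apply: le_total.
move=> /(sorted_leq_nth ge_trans ge_refl 0) h.
by apply: h => //; rewrite inE size_tuple.
Qed.

Lemma suborthonormal_comp (C : numClosedFieldType) (I J T : finType)
    (w : I -> T -> C) (h : J -> I) :
  injective h -> suborthonormal w -> suborthonormal (fun j => w (h j)).
Proof.
by move=> hI [b hb]; exists (b \o h) => i j; rewrite hb (inj_eq hI).
Qed.

Lemma suborthonormal_reindex (C : numClosedFieldType) (I S T : finType)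
    (w : I -> T -> C) (h : S -> T) :
  bijective h -> suborthonormal w -> suborthonormal (fun i s => w i (h s)).
Proof.
move=> hB [b hb]; exists b => i j; rewrite -hb.
by rewrite [RHS](reindex h) //; apply: onW_bij.
Qed.

Lemma suborthonormal_pad (C : numClosedFieldType) (n N : nat) (T : finType)
    (w : 'I_n -> T -> C) :
  suborthonormal w ->
  suborthonormal (fun (j : 'I_N) x => oapp (w^~ x) 0 (insub (val j))).
Proof.
move=> [b hb]; exists (fun j : 'I_N => oapp b false (insub (val j))) => i j.
case: (insubP 'I_n (val i)) => [i' _ ei|_] /=; last first.
  by rewrite andbF big1 // => x _; rewrite mul0r.
case: (insubP 'I_n (val j)) => [j' _ ej|hj] /=.
  by rewrite hb -val_eqE ei ej.
rewrite big1 => [|x _]; last by rewrite rmorph0 mulr0.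
have [e|//] := eqVneq i j.
by move: hj; rewrite -e -ei ltn_ord.
Qed.

Lemma sum_pad (V : nmodType) (n N : nat) (F : 'I_n -> V) :
  (n <= N)%N -> \sum_(j < N) oapp F 0 (insub (val j)) = \sum_j F j.
Proof.
move=> nN; pose H k := oapp F 0 (insub k).
rewrite -(big_mkord xpredT H) (big_cat_nat (n := n)) //= big_mkord.
rewrite [X in _ + X]big1_seq ?addr0 => [|k]; last first.
  by rewrite mem_index_iota /H => /andP [_ /andP [nk _]]; rewrite insubF // ltnNge nk.
by apply: eq_bigr => j _; rewrite /H valK.
Qed.

(** [svd_mx] adapted to [cyclic_sum_svd_le]: zero padding gives all factors one index type ['I_N],
    and a permutation sorts the values. The clause on [F] lets norms be read off the original
    singular values. *)
Lemma schatten_svd (R : realType) (X Y : finType) (P : X -> R) (Q : Y -> R)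
    (f : X -> Y -> R[i]) (N : nat) :
  (#|Y| <= N)%N ->
  exists (s : 'I_N -> R) (w : 'I_N -> X -> R[i]) (v : 'I_N -> Y -> R[i]),
    [/\ suborthonormal w /\ suborthonormal v,
      forall j, 0 <= s j,
      forall i j : 'I_N, (i <= j)%N -> s j <= s i,
      forall x y, f x y * (Num.sqrt (P x * Q y))%:C%C =
        \sum_j (s j)%:C%C * (w j x * v j y) &
      forall F : R -> R, F 0 = 0 ->
        \sum_j F (s j) =
        \sum_j F (singular_value (weighted_mx P Q f) j)].
Proof.
move=> hN; set A := weighted_mx P Q f.
have [w [v [hw hv hA]]] := svd_mx A.
pose pad (V : Type) (z : V) (F : 'I_#|Y| -> V) (j : 'I_N) :=
  oapp F z (insub (val j)).
have [p hp] := sort_perm_decreasing (pad _ 0 (singular_value A)).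
exists (fun j => pad _ 0 (singular_value A) (p j)).
exists (fun j x => pad _ 0 (fun i => w i (enum_rank x)) (p j)).
exists (fun j y => pad _ 0 (fun i => v i (enum_rank y)) (p j)).
split=> //.
- split.
    apply: (suborthonormal_comp (w := fun j x => pad _ 0 (fun i => w i (enum_rank x)) j)
      (@perm_inj _ p)).
    apply: (@suborthonormal_pad _ _ N _ (fun i x => w i (enum_rank x))).
    by apply: (suborthonormal_reindex (enum_rank_bij X)).
  apply: (suborthonormal_comp (w := fun j x => pad _ 0 (fun i => v i (enum_rank x)) j)
      (@perm_inj _ p)).
    apply: (@suborthonormal_pad _ _ N _ (fun i x => v i (enum_rank x))).
    by apply: (suborthonormal_reindex (enum_rank_bij Y)).
- by move=> j; rewrite /pad; case: insub => //= k; apply: sqrtr_ge0.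
- move=> x y.
  have -> : f x y * (Num.sqrt (P x * Q y))%:C%C = A (enum_rank x) (enum_rank y).
    by rewrite mxE !enum_rankK.
  rewrite hA -(sum_pad _ hN) (reindex_inj (@perm_inj _ p)).
  by apply: eq_bigr => j _; rewrite /pad; case: insub => //=; rewrite !mul0r.
move=> F F0; rewrite -(sum_pad _ hN) [RHS](reindex_inj (@perm_inj _ p)) /=.
by apply: eq_bigr => j _; rewrite /pad; case: insub.
Qed.

(** * Hölder's inequality for cyclic expectations, and telescoping *)

Lemma dependent_choice (I : Type) (T : I -> Type) (Q : forall i, T i -> Prop) :
  (forall i, exists x, Q i x) -> exists f : forall i, T i, forall i, Q i (f i).
Proof.
by move=> h; exists (fun i => projT1 (cid (h i))) => i; apply: (projT2 (cid (h i))).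
Qed.

(** The hybrid product [H m] takes its first [m] factors from [b] and the others from [a];
    consecutive hybrids differ only in factor [m]. *)
Lemma prodB_telescope (V : comNzRingType) (k : nat) (a b : 'I_k -> V) :
  \prod_i a i - \prod_i b i =
  \sum_(m < k) \prod_i (if i == m then a i - b i
                        else if (i < m)%N then b i else a i).
Proof.
pose H m := \prod_(i < k) (if (i < m)%N then b i else a i).
transitivity (H 0%N - H k).
  by congr (_ - _); apply: eq_bigr => i _; rewrite ?ltn_ord.
rewrite -opprB -(telescope_sumr H (leq0n k)) -sumrN big_mkord.
apply: eq_bigr => m _; rewrite opprB /H.
rewrite (bigD1 m) //= ltnn [X in _ - X](bigD1 m) //= ltnSn [RHS](bigD1 m) //= eqxx.
have e (i : 'I_k) : i != m -> (i < m.+1)%N = (i < m)%N.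
  by move=> ni; rewrite ltnS leq_eqVlt val_eqE (negPf ni).
rewrite mulrBl; congr (_ * _ - _ * _); apply: eq_bigr => i ni.
  by rewrite (negPf ni).
by rewrite (negPf ni) e.
Qed.

(** Each [p i] sits under two square roots, at [i] and at its cyclic predecessor. Hence the weights
    in the matrices multiply to the product measure. *)
Lemma prod_sqrt_cyclic (R : realType) (k : nat) (p : 'I_k -> R) :
  (forall i, 0 <= p i) ->
  \prod_i Num.sqrt (p i * p (ordS i)) = \prod_i p i.
Proof.
move=> p0; under eq_bigr do rewrite sqrtrM //.
rewrite big_split /=.
have <- : \prod_i Num.sqrt (p i) = \prod_i Num.sqrt (p (ordS i)).
  by rewrite (reindex_inj (@ordS_inj k)).
by rewrite -big_split; apply: eq_bigr => i _ /=; rewrite -expr2 sqr_sqrtr.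
Qed.

(** Hölder's inequality for Schatten norms around a cycle: absorb the probabilities into the
    matrices, pass to singular values by [cyclic_sum_svd_le], and apply the scalar inequality with
    the reciprocals of [p i] as exponents. *)
Lemma indep_expect_cyclic_le (R : realType) (n : nat)
    (X : 'I_n.+1 -> finType) (P : forall i, X i -> R)
    (f : forall i, X i -> X (ordS i) -> R[i]) (p : 'I_n.+1 -> \bar R)
    (c : 'I_n.+1 -> R) :
  (forall i x, 0 <= P i x) -> (forall i, (1 <= p i)%E) ->
  1 <= \sum_i fine (p i)^-1%E -> (forall i, 0 < c i) ->
  (forall i, schatten_norm (P i) (P (ordS i)) (p i) (f i) <= c i) ->
  `| indep_expect P (fun x => \prod_i f i (x i) (x (ordS i))) |
    <= (\prod_i c i)%:C%C.
Proof.
move=> P0 p1 hp c0 hf.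
pose N := \max_i #|X i|.
have hN i : (#|X (ordS i)| <= N)%N by apply: (leq_bigmax (ordS i)).
have h0 i := schatten_svd (P i) (P (ordS i)) (f i) (hN i).
have [s h1] := dependent_choice h0.
have [w h2] := dependent_choice h1.
have [v h3] := dependent_choice h2.
have s0 i j : 0 <= s i j by have [_ + _ _ _] := h3 i; apply.
have -> : indep_expect P (fun x => \prod_i f i (x i) (x (ordS i))) =
    \sum_(x : {dffun forall i, X i}) \prod_i \sum_j
       (s i j)%:C%C * (w i j (x i) * v i j (x (ordS i))).
  apply: eq_bigr => x _.
  rewrite -(@prod_sqrt_cyclic _ _ (fun i => P i (x i))) //.
  rewrite mulrC rmorph_prod -big_split; apply: eq_bigr => i _ /=.
  by have [_ _ _ -> _] := h3 i.
apply: (le_trans (cyclic_sum_svd_le (s := fun i j => (s i j)%:C%C) _ _ _ _)).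
- by move=> i; have [[]] := h3 i.
- by move=> i; have [[]] := h3 i.
- by move=> i j; rewrite ler0c.
- by move=> i j j' jj'; rewrite lecR; have [_ _ + _ _] := h3 i; apply.
have -> : \sum_j \prod_i (s i j)%:C%C = (\sum_j \prod_i s i j)%:C%C :> R[i].
  by rewrite rmorph_sum; apply: eq_bigr => j _; rewrite rmorph_prod.
rewrite lecR.
have ha i : exists a : 'I_N -> R, [/\ forall j, 0 <= a j, \sum_j a j <= 1 &
    forall j, s i j <= c i * a j `^ fine (p i)^-1%E].
  apply: (lq_norm_le_dominated (p1 i) (c0 i) (s0 i) _ _ (hf i)).
    by move=> j; apply: sqrtr_ge0.
  by have [] := h3 i.
have /choice [a ha'] := ha.
apply: (sum_prod_le_holder (theta := fun i => fine (p i)^-1%E) (a := a)) => //.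
- move=> i; have := p1 i; case: (p i) => [q||] // q1.
  rewrite lee_fin in q1; have q0 : 0 < q by apply: lt_le_trans q1.
  by rewrite inver gt_eqF //= invr_ge0 ltW.
- by move=> i; apply: ltW.
- by move=> i; have [] := ha' i.
- by move=> i; have [] := ha' i.
- by move=> i j; rewrite s0; have [_ _ ->] := ha' i.
Qed.

Theorem lemma4p1 (R : realType) (k : nat) (hk : (2 <= k)%N)
    (q : 'I_k -> R) (r : 'I_k -> \bar R)
    (hq : forall i, 1 <= q i)
    (hr : forall i, (1 < r i)%E)
    (hqr : forall i,
      (1 <= (r i)^-1 + (\sum_(j < k | j != i) (q j)^-1)%R%:E)%E)
    (eps C : R) (heps : 0 < eps) (hC : 0 < C)
    (X : 'I_k -> finType) (P : forall i, X i -> R)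
    (hP : forall i, is_pmf (P i))
    (f ft : forall i, X i -> X (ordS i) -> R[i])
    (hf : forall i,
      schatten_norm (P i) (P (ordS i)) (q i)%:E (f i) <= C)
    (hft : forall i,
      schatten_norm (P i) (P (ordS i)) (q i)%:E (ft i) <= C)
    (hfft : forall i,
      schatten_norm (P i) (P (ordS i)) (r i) (fun x y => f i x y - ft i x y)
        <= eps) :
  `| indep_expect P (fun x => \prod_(i < k) f i (x i) (x (ordS i)))
     - indep_expect P (fun x => \prod_(i < k) ft i (x i) (x (ordS i))) |
    <= (k%:R * C ^+ k.-1 * eps)%:C%C.
Proof.
case: k hk => [|n] // hk in q r hq hr hqr X P hP f ft hf hft hfft *.
(* The [m]-th telescoping term: the difference at [m] is measured in the [r m] norm by [eps], every
   other factor in its [q i] norm by [C]. *)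
pose g (m i : 'I_n.+1) (a : X i) (b : X (ordS i)) : R[i] :=
  if i == m then f i a b - ft i a b else if (i < m)%N then ft i a b else f i a b.
pose p (m i : 'I_n.+1) := if i == m then r i else (q i)%:E.
pose c (m i : 'I_n.+1) := if i == m then eps else C.
have -> : indep_expect P (fun x => \prod_i f i (x i) (x (ordS i)))
     - indep_expect P (fun x => \prod_i ft i (x i) (x (ordS i))) =
    \sum_m indep_expect P (fun x => \prod_i g m i (x i) (x (ordS i))).
  rewrite /indep_expect exchange_big -sumrB; apply: eq_bigr => x _.
  by rewrite -mulrBr prodB_telescope mulr_sumr.
have -> : (n.+1%:R * C ^+ n.+1.-1 * eps)%:C%C = \sum_m (\prod_i c m i)%:C%C :> R[i].
  rewrite -rmorph_sum /=; congr (_%:C%C).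
  rewrite -mulrA mulr_natl -[n.+1 in LHS]card_ord -sumr_const.
  apply: eq_bigr => m _; rewrite (bigD1 m) //= /c eqxx mulrC; congr (_ * _).
  under eq_bigr => i /negPf ni do rewrite ni.
  by rewrite prodr_const cardC1 card_ord.
apply: (le_trans (ler_norm_sum _ _ _)); apply: ler_sum => m _.
apply: (indep_expect_cyclic_le (p := p m)).
- by move=> i x; case: (hP i) => + _; apply.
- move=> i; rewrite /p; case: eqP => _; last by rewrite lee_fin.
  exact: ltW.
(* The reciprocal exponents of the [m]-th term sum to the left-out-[m] expression that [hqr m]
   bounds below by 1. *)
- rewrite (bigD1 m) //= /p eqxx.
  under eq_bigr => i /negPf ni do rewrite ni.
  have -> : \sum_(i | i != m) fine ((q i)%:E^-1)%E = \sum_(j | j != m) (q j)^-1.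
    apply: eq_bigr => i _; rewrite inver gt_eqF //.
    exact: lt_le_trans (hq i).
  have := hqr m; have := hr m; case: (r m) => [r0||] // r1.
  rewrite inver; case: eqP => [r00|_]; last by rewrite -EFinD lee_fin.
  by move: r1; rewrite r00 lte_fin ltr10.
- by move=> i; rewrite /c; case: ifP.
- move=> i; rewrite /g /p /c; case: eqP => _; first exact: hfft.
  by case: (i < m)%N; [apply: hft|apply: hf].
Qed.
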